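(* Let $\mathcal{C}=\{\mathbf{c}_1,\dots,\mathbf{c}_l\}\subseteq G$, let $\mathcal{D}\subseteq G$ be a subset, let $p\ge 0$ be an integer and let $\mathbf{d}\in G$. Then $\mathbf{d}\in\mathrm{dreg}_{B,\mathcal{C}}(\mathcal{D})_p$ if and only if $$\mathcal{D}\subseteq\bigl(\mathbf{d}+\mathrm{reg}_{B,\mathcal{C}}(S)+\mathbb{N}\mathcal{C}[-p]\bigr)\cap\bigcap_{j=1}^{l}\bigl(\mathbf{d}-\mathbf{c}_j+\mathrm{reg}_{B,\mathcal{C}}(S)+\mathbb{N}\mathcal{C}[1-p]\bigr).$$
   Context: $K$ is a field, $G$ is a finitely generated abelian group, $S=K[x_1,\dots,x_n]$ is a $G$-graded polynomial $K$-algebra with $\deg x_i=\mathbf{a}_i\in G$, and $B\subset S$ is a $G$-graded ideal. $\mathbb{N}=\mathbb{Z}_{\ge 0}$. For a finite set $\mathcal{C}=\{\mathbf{c}_1,\dots,\mathbf{c}_l\}\subseteq G$, $\mathbb{N}\mathcal{C}$ is the sub-semigroup of $G$ (containing $\mathbf{0}$) generated by $\mathcal{C}$, and for $j\in\mathbb{Z}$ $$\mathbb{N}\mathcal{C}[j]=\bigcup_{\mathbf{w}\in\mathbb{N}^l,\ \sum w_i=|j|}\bigl(\mathrm{sign}(j)(w_1\mathbf{c}_1+\dots+w_l\mathbf{c}_l)+\mathbb{N}\mathcal{C}\bigr),$$ so $\mathbb{N}\mathcal{C}[0]=\mathbb{N}\mathcal{C}$. Sums of subsets of $G$ are Minkowski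 sums. For a $G$-graded $S$-module $M$, $H^i_B(M)$ is the ($G$-graded) local cohomology, and $$\mathrm{reg}_{B,\mathcal{C}}(M)=\{\mathbf{m}\in G: H^i_B(M)_{\mathbf{p}}=0\ \text{for all } i\ge 0 \text{ and all } \mathbf{p}\in\mathbf{m}+\mathbb{N}\mathcal{C}[1-i]\}.$$ For $\mathcal{D}\subseteq G$, $\mathrm{dreg}_{B,\mathcal{C}}(\mathcal{D})$ is the collection $\{K_0,K_1,\dots\}$ with $$\mathrm{dreg}_{B,\mathcal{C}}(\mathcal{D})_p=K_p=\{\mathbf{d}\in G:\ \mathcal{D}+\mathbb{N}\mathcal{C}[1-i]\subseteq\mathbf{d}+\mathrm{reg}_{B,\mathcal{C}}(S)+\mathbb{N}\mathcal{C}[1-i-p]\ \text{for all } i\ge 0\}.$$ *)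

(* Defs.v *)
From HB Require Import structures.
From mathcomp Require Import all_boot all_order all_algebra.
From mathcomp Require Import boolp classical_sets mpoly.
Set Implicit Arguments.
Unset Strict Implicit.
Unset Printing Implicit Defensive.
Import GRing.Theory.
Local Open Scope ring_scope.
Local Open Scope classical_set_scope.

Definition fin_gen_group (G : zmodType) : Prop :=
  exists (r : nat) (g : 'I_r -> G),
    forall x : G, exists z : 'I_r -> int, x = \sum_(i < r) g i *~ z i.

(* Minkowski sum.  The library's  A `+` B  is the symmetric difference. *)
Definition msum (G : zmodType) (A B : set G) : set G :=
  [set x + y | x in A & y in B].
Notation "A :+: B" := (msum A B) (at level 50, left associativity).

(* Throughout, S = K[x_1, ..., x_n] is G-graded by deg x_i = a i. *)

Definition mondeg (G : zmodType) (n : nat) (a : 'I_n -> G)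
  (m : 'X_{1.. n}) : G := \sum_(i < n) a i *+ m i.

Definition hdeg (K : fieldType) (G : zmodType) (n : nat) (a : 'I_n -> G)
    (g : G) : set {mpoly K[n]} :=
  [set f | forall m, m \in msupp f -> mondeg a m = g].

Definition hcomp (K : fieldType) (G : zmodType) (n : nat) (a : 'I_n -> G)
    (g : G) (f : {mpoly K[n]}) : {mpoly K[n]} :=
  \sum_(m <- msupp f | mondeg a m == g) f@_m *: 'X_[m].

Record graded_ideal (K : fieldType) (G : zmodType) (n : nat) (a : 'I_n -> G)
    (B : set {mpoly K[n]}) : Prop := GradedIdeal {
  graded_ideal0 : B 0;
  graded_idealD : forall f g, B f -> B g -> B (f + g);
  graded_idealM : forall f g, B g -> B (f * g);
  graded_ideal_hcomp : forall f, B f -> forall g, B (hcomp a g f)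
}.

Definition ideal_prod (R : comNzRingType) (I J : set R) : set R :=
  [set f | exists s : seq (R * R),
     (forall u, u \in s -> I u.1 /\ J u.2) /\ f = \sum_(u <- s) u.1 * u.2].

Fixpoint ideal_exp (R : comNzRingType) (I : set R) (k : nat) : set R :=
  if k is k'.+1 then ideal_prod I (ideal_exp I k') else setT.

(* An internal direct sum decomposition M = \bigoplus_g M_g into additive
   subgroups with S_g M_h contained in M_(g + h). *)
Record gradedModule (K : fieldType) (G : zmodType) (n : nat)
    (a : 'I_n -> G) := GradedModule {
  gm_sort :> lmodType {mpoly K[n]};
  gm_comp : G -> set gm_sort;
  gm_comp0 : forall g, gm_comp g 0;
  gm_compB : forall g x y, gm_comp g x -> gm_comp g y -> gm_comp g (x - y);
  gm_compZ : forall g h f x,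
    hdeg a g f -> gm_comp h x -> gm_comp (g + h) (f *: x);
  gm_span : forall x : gm_sort, exists (s : seq G) (u : G -> gm_sort),
    (forall g, gm_comp g (u g)) /\ x = \sum_(g <- s) u g;
  gm_direct : forall (s : seq G) (u : G -> gm_sort), uniq s ->
    (forall g, gm_comp g (u g)) -> \sum_(g <- s) u g = 0 ->
    forall g, g \in s -> u g = 0
}.

Definition deg_preserving (K : fieldType) (G : zmodType) (n : nat)
    (a : 'I_n -> G) (M N : gradedModule K a) (f : M -> N) : Prop :=
  forall g x, gm_comp g x -> gm_comp g (f x).

Lemma hdeg0 (K : fieldType) (G : zmodType) (n : nat) (a : 'I_n -> G) g :
  hdeg a g (0 : {mpoly K[n]}).
Proof. by move=> m; rewrite msupp0. Qed.

Lemma hdegB (K : fieldType) (G : zmodType) (n : nat) (a : 'I_n -> G) g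
    (p q : {mpoly K[n]}) :
  hdeg a g p -> hdeg a g q -> hdeg a g (p - q).
Proof.
move=> hp hq m /msuppB_le; rewrite mem_cat => /orP[/hp|/hq] //.
Qed.

Lemma mondegD (G : zmodType) (n : nat) (a : 'I_n -> G) (m m' : 'X_{1.. n}) :
  mondeg a (m + m')%MM = mondeg a m + mondeg a m'.
Proof.
by rewrite /mondeg -big_split; apply: eq_bigr => i _; rewrite mnmDE mulrnDr.
Qed.

Lemma hdegM (K : fieldType) (G : zmodType) (n : nat) (a : 'I_n -> G) g h
    (p q : {mpoly K[n]}) :
  hdeg a g p -> hdeg a h q -> hdeg a (g + h) (p * q).
Proof.
move=> hp hq m /msuppM_le /allpairsP[[m1 m2] /= [m1p m2q ->]].
by rewrite mondegD (hp _ m1p) (hq _ m2q).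
Qed.

Lemma hdeg_hcomp (K : fieldType) (G : zmodType) (n : nat) (a : 'I_n -> G) g
    (p : {mpoly K[n]}) :
  hdeg a g (hcomp a g p).
Proof.
move=> m; rewrite mcoeff_msupp /hcomp raddf_sum /= => nz.
apply/eqP; apply: contraNT nz => ne.
apply/eqP/big1_seq => m' /andP[/eqP e _]; rewrite mcoeffZ mcoeffX.
by case: eqP => [em|_]; rewrite ?mulr0 // -em e eqxx in ne *.
Qed.

Lemma hcomp_span (K : fieldType) (G : zmodType) (n : nat) (a : 'I_n -> G)
    (p : {mpoly K[n]}) :
  p = \sum_(g <- undup (map (mondeg a) (msupp p))) hcomp a g p.
Proof.
rewrite {1}[p]mpolyE /hcomp.
rewrite (exchange_big_dep xpredT) //=; apply: eq_big_seq => m mp.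
rewrite (big_rem (mondeg a m)) ?mem_undup ?map_f //= eqxx big1_seq ?addr0 //.
move=> g /andP[/eqP <-]; by rewrite mem_rem_uniqF // undup_uniq.
Qed.

Lemma hdeg_direct (K : fieldType) (G : zmodType) (n : nat) (a : 'I_n -> G)
    (s : seq G) (u : G -> {mpoly K[n]}) : uniq s ->
  (forall g, hdeg a g (u g)) -> \sum_(g <- s) u g = 0 ->
  forall g, g \in s -> u g = 0.
Proof.
move=> us hu s0 g gs; apply/mpolyP => m; rewrite mcoeff0.
have [//|nz] := eqVneq (u g)@_m 0.
have mg : mondeg a m = g by apply: hu; rewrite mcoeff_msupp.
have := congr1 (mcoeff m) s0; rewrite raddf_sum /= mcoeff0 (big_rem g) //=.
rewrite [X in _ + X]big1_seq ?addr0 // => h /andP[_ hs].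
apply/eqP; rewrite mcoeff_eq0; apply/negP => /(hu h) e.
by move: hs; rewrite -e mg mem_rem_uniqF.
Qed.

Definition gradedS (K : fieldType) (G : zmodType) (n : nat) (a : 'I_n -> G) :
  gradedModule K a :=
  @GradedModule K G n a {mpoly K[n]}^o (@hdeg K G n a)
    (@hdeg0 K G n a) (@hdegB K G n a) (@hdegM K G n a)
    (fun p => ex_intro _ _ (ex_intro _ _
       (conj (fun g => @hdeg_hcomp K G n a g p) (@hcomp_span K G n a p))))
    (@hdeg_direct K G n a).

(* H^i_B is the i-th right derived functor of the B-torsion functor on the
   category of G-graded S-modules and degree-preserving S-linear maps. *)

Definition torsion (K : fieldType) (G : zmodType) (n : nat) (a : 'I_n -> G)
    (B : set {mpoly K[n]}) (M : gradedModule K a) : set M :=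
  [set x | exists k : nat, forall f, ideal_exp B k f -> f *: x = 0].

Definition gr_injective (K : fieldType) (G : zmodType) (n : nat)
    (a : 'I_n -> G) (I : gradedModule K a) : Prop :=
  forall (M N : gradedModule K a)
    (j : {linear M -> N}) (f : {linear M -> I}),
    deg_preserving j -> deg_preserving f -> injective j ->
    exists h : {linear N -> I},
      deg_preserving h /\ forall x, h (j x) = f x.

Record gr_injective_resolution (K : fieldType) (G : zmodType) (n : nat)
    (a : 'I_n -> G) (M : gradedModule K a) := GrInjectiveResolution {
  res_obj : nat -> gradedModule K a;
  res_aug : {linear M -> res_obj 0};
  res_diff : forall i, {linear res_obj i -> res_obj i.+1};
  res_obj_inj : forall i, gr_injective (res_obj i);
  res_aug_deg : deg_preserving res_aug;
  res_diff_deg : forall i, deg_preserving (res_diff i);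
  res_aug_inj : injective res_aug;
  res_exact0 : forall x, res_diff 0 x = 0 <-> exists y, res_aug y = x;
  res_exact : forall i x,
    res_diff i.+1 x = 0 <-> exists y, res_diff i y = x
}.

(* Degree-p cocycles and coboundaries of the complex obtained by applying
   the B-torsion functor to the resolution. *)
Definition lc_cocycle (K : fieldType) (G : zmodType) (n : nat)
    (a : 'I_n -> G) (B : set {mpoly K[n]}) (M : gradedModule K a)
    (I : gr_injective_resolution M) (i : nat) (p : G) :
    set (res_obj I i) :=
  [set x | gm_comp p x /\ torsion B x /\ res_diff I i x = 0].
Arguments lc_cocycle {K G n a} B {M} I i p.

Definition lc_coboundary (K : fieldType) (G : zmodType) (n : nat)
    (a : 'I_n -> G) (B : set {mpoly K[n]}) (M : gradedModule K a)
    (I : gr_injective_resolution M) (i : nat) (p : G) :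
    set (res_obj I i) :=
  if i is j.+1 then
    [set x | exists y : res_obj I j,
       gm_comp p y /\ torsion B y /\ res_diff I j y = x]
  else [set 0].
Arguments lc_coboundary {K G n a} B {M} I i p.

(* H^i_B(M)_p = 0.  Every M has a graded injective resolution and H^i_B(M)_p
   does not depend on its choice. *)
Definition local_cohomology_zero (K : fieldType) (G : zmodType) (n : nat)
    (a : 'I_n -> G) (B : set {mpoly K[n]}) (M : gradedModule K a)
    (i : nat) (p : G) : Prop :=
  exists I : gr_injective_resolution M,
    lc_cocycle B I i p `<=` lc_coboundary B I i p.

(* The finite set C is enumerated by c : 'I_l -> G. *)

Definition NC (G : zmodType) (l : nat) (c : 'I_l -> G) : set G :=
  [set x | exists w : 'I_l -> nat, x = \sum_(i < l) c i *+ w i].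

Definition NCj (G : zmodType) (l : nat) (c : 'I_l -> G) (j : int) : set G :=
  \bigcup_(w in [set w : 'I_l -> nat | (\sum_(i < l) w i)%N = `|j|%N])
    ([set (\sum_(i < l) c i *+ w i) *~ sgz j] :+: NC c).

Definition reg (K : fieldType) (G : zmodType) (n : nat) (a : 'I_n -> G)
    (B : set {mpoly K[n]}) (l : nat) (c : 'I_l -> G) (M : gradedModule K a) :
    set G :=
  [set m | forall (i : nat) (p : G), ([set m] :+: NCj c (1 - i%:Z)) p ->
     local_cohomology_zero B M i p].

Definition dreg (K : fieldType) (G : zmodType) (n : nat) (a : 'I_n -> G)
    (B : set {mpoly K[n]}) (l : nat) (c : 'I_l -> G) (D : set G) (p : nat) :
    set G :=
  [set d | forall i : nat,
     D :+: NCj c (1 - i%:Z) `<=`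
       [set d] :+: reg B c (gradedS K a) :+: NCj c (1 - i%:Z - p%:Z)].
Arguments dreg {K G n} a B {l} c D p.

(* Main.v *)
Require Import Defs.
From mathcomp Require Import all_boot all_order all_algebra.
From mathcomp Require Import boolp classical_sets mpoly.
Set Implicit Arguments.
Unset Strict Implicit.
Unset Printing Implicit Defensive.
Import GRing.Theory.
Local Open Scope ring_scope.
Local Open Scope classical_set_scope.

(** Of the infinitely many inclusions defining [dreg], those for [i = 0] and [i = 1] imply the rest.
    Since 0 lies in NC[0], the case [i = 1] puts [D] inside d + R + NC[-p], where R is the
    regularity set of S. Conversely, adding NC[1-i] = NC[-(i-1)] to this yields every case [i >= 1],
    because NC[-k] + NC[-m] is contained in NC[-(k+m)] ([NCj_oppD]). For [i = 0], NC[1] is the union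
    of the c_j + NC ([NCj1P]), and each NC[k] is stable under adding NC ([NCj_addNC]), so it is
    enough to test the translates D + c_j; moving c_j to the other side gives the intersection. *)

Lemma sum_mulrnD (G : zmodType) (l : nat) (c : 'I_l -> G) (v w : 'I_l -> nat) :
  \sum_(i < l) c i *+ (v i + w i) =
  \sum_(i < l) c i *+ v i + \sum_(i < l) c i *+ w i.
Proof. by rewrite -big_split; apply: eq_bigr => i _; rewrite mulrnDr. Qed.

Lemma sum_mulrn_delta (G : zmodType) (l : nat) (c : 'I_l -> G) (j : 'I_l) :
  \sum_(i < l) c i *+ (i == j) = c j.
Proof.
by rewrite (bigD1 j) //= eqxx big1 ?addr0 // => i /negPf ->.
Qed.

Lemma NC0 (G : zmodType) (l : nat) (c : 'I_l -> G) : NC c 0.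
Proof. by exists (fun=> 0%N); rewrite big1. Qed.

Lemma NCD (G : zmodType) (l : nat) (c : 'I_l -> G) x y :
  NC c x -> NC c y -> NC c (x + y).
Proof.
by move=> [v ->] [w ->]; exists (fun i => (v i + w i)%N); rewrite sum_mulrnD.
Qed.

Lemma NCj_addNC (G : zmodType) (l : nat) (c : 'I_l -> G) (j : int) x y :
  NCj c j x -> NC c y -> NCj c j (x + y).
Proof.
move=> [w wj [_ -> [z cz <-]]] cy; exists w => //.
by exists ((\sum_(i < l) c i *+ w i) *~ sgz j) => //; exists (z + y);
  [exact: NCD | rewrite addrA].
Qed.

(* For [k = 0] the sign factor is [0], but then so is [w]. *)
Lemma NCj_oppP (G : zmodType) (l : nat) (c : 'I_l -> G) (k : nat) x :
  NCj c (- k%:Z) x <->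
  exists w : 'I_l -> nat, (\sum_(i < l) w i)%N = k /\
    NC c (x + \sum_(i < l) c i *+ w i).
Proof.
have sgE (w : 'I_l -> nat) : (\sum_(i < l) w i)%N = k ->
    (\sum_(i < l) c i *+ w i) *~ sgz (- k%:Z) = - \sum_(i < l) c i *+ w i.
  case: k => [/eqP|k _]; last by rewrite mulrN1z.
  rewrite sum_nat_eq0 => /forallP w0.
  by rewrite oppr0 mulr0z big1 ?oppr0 // => i _; rewrite (eqP (w0 i)).
split=> [[w /=]|[w [wk cx]]].
  rewrite abszN => wk [_ -> [z cz <-]]; exists w; split=> //.
  by rewrite sgE // addrAC addNr add0r.
exists w; first by rewrite /= abszN.
exists (- \sum_(i < l) c i *+ w i); first by rewrite /= sgE.
by exists (x + \sum_(i < l) c i *+ w i) => //; rewrite addrC addrK.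
Qed.

(** Both indices are nonpositive, so the weight vectors add without cancellation and their total is
    [k + m]. *)
Lemma NCj_oppD (G : zmodType) (l : nat) (c : 'I_l -> G) (k m : nat) x y :
  NCj c (- k%:Z) x -> NCj c (- m%:Z) y -> NCj c (- (k + m)%N%:Z) (x + y).
Proof.
move=> /NCj_oppP[v [vk cx]] /NCj_oppP[w [wm cy]]; apply/NCj_oppP.
exists (fun i => (v i + w i)%N); split; first by rewrite big_split /= vk wm.
by rewrite sum_mulrnD addrACA; exact: NCD.
Qed.

Lemma NCj0 (G : zmodType) (l : nat) (c : 'I_l -> G) : NCj c 0 0.
Proof.
apply/(NCj_oppP c 0); exists (fun=> 0%N); split; first by rewrite big1.
by rewrite add0r big1 //; exact: NC0.
Qed.

Lemma NCj1P (G : zmodType) (l : nat) (c : 'I_l -> G) x :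
  NCj c 1 x <-> exists j, NC c (x - c j).
Proof.
split=> [[w /= w1 [_ -> [z cz <-]]]|[j cx]].
  have [j wj] : exists j, (0 < w j)%N.
    apply/existsP; apply: contra_eqT w1; rewrite negb_exists => /forallP w0.
    by rewrite big1 // => i _; apply/eqP; rewrite -leqn0 leqNgt.
  (* One unit is split off at [j]; the truncated subtraction is exact because [w j] is positive. *)
  have wE i : w i = ((i == j) + (w i - (i == j)))%N.
    by rewrite subnKC //; case: eqP => [->|].
  exists j; rewrite mulr1z (eq_bigr _ (fun i _ => congr1 _ (wE i))).
  rewrite sum_mulrnD sum_mulrn_delta -[c j + _ + z]addrA addrAC subrr add0r.
  by apply: NCD => //; exists (fun i => (w i - (i == j))%N).
exists (fun i => (i == j : nat)).
  by rewrite /= (bigD1 j) //= eqxx big1 ?addn0 // => i /negPf ->.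
by exists (c j); rewrite /= ?mulr1z ?sum_mulrn_delta //; exists (x - c j);
  rewrite // addrC subrK.
Qed.

Theorem theorem3p16 (K : fieldType) (G : zmodType) (hG : fin_gen_group G)
    (n : nat) (a : 'I_n -> G) (B : set {mpoly K[n]}) (hB : graded_ideal a B)
    (l : nat) (c : 'I_l -> G) (D : set G) (p : nat) (d : G) :
  dreg a B c D p d <->
  D `<=` ([set d] :+: reg B c (gradedS K a) :+: NCj c (- p%:Z)) `&`
         \bigcap_(j in [set: 'I_l])
           ([set d - c j] :+: reg B c (gradedS K a) :+: NCj c (1 - p%:Z)).
Proof.
set R := reg _ _ _.
(* For a positive cohomological index the target index is the opposite of a natural number; [q = 0]
   gives the source index. *)
have oppE (i q : nat) : 1 - i.+1%:Z - q%:Z = - (q + i)%N%:Z.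
  by rewrite -addn1 !PoszD !opprD [- i%:Z - 1]addrC addrA subrr add0r addrC.
split=> [dD x Dx|dD [|i] _ [x Dx [y cy <-]]].
- split.
    have := dD 1%N x; rewrite oppE addn0 subrr; apply.
    by exists x => //; exists 0; [exact: NCj0 | rewrite addr0].
  (* The inclusion for [i = 0] is applied to [x + c j], and [c j] is then subtracted. *)
  move=> j _; have Dxc : (D :+: NCj c (1 - 0%:Z)) (x + c j).
    exists x => //; exists (c j) => //; rewrite subr0; apply/NCj1P.
    by exists j; rewrite subrr; exact: NC0.
  have [_ [_ -> [r Rr <-]] [z cz e]] := dD 0%N _ Dxc.
  exists (d - c j + r); first by exists (d - c j) => //; exists r.
  exists z; first by rewrite subr0 in cz.
  by rewrite -[RHS](addrK (c j)) -e [d - c j + r]addrAC [LHS]addrAC.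
- have [_ /=] := dD x Dx; move: cy; rewrite !subr0 => /NCj1P[j cy].
  move=> /(_ j I)[_ [_ -> [r Rr <-]] [z cz <-]].
  exists (d + r); first by exists d => //; exists r.
  (* As x + y = (x + c_j) + (y - c_j), the part of [y] beyond [c j] is absorbed into the last
     summand. *)
  exists (z + (y - c j)); first exact: NCj_addNC.
  by rewrite !addrA [d - c j + r]addrAC [d + r - c j + z]addrAC [RHS]addrAC.
- have [[e De [z cz <-]] _] := dD x Dx.
  exists e => //; exists (z + y); last by rewrite addrA.
  rewrite oppE; apply: NCj_oppD => //.
  by have := oppE i 0%N; rewrite subr0 add0n => <-.
Qed.
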